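(* Let $G$ be a finite group and $N\trianglelefteq G$. Then there is an injective group homomorphism \[\mathrm{dBInf}_{G/N}^G:B(G/N,G/N)^\times\to B(G,G)^\times\] defined by \[u\mapsto \mathrm{Id}_G+\mathrm{Inf}_{G/N}^G\circ(u-\mathrm{Id}_{G/N})\circ\mathrm{Def}_{G/N}^G\] for all $u\in B(G/N,G/N)^\times$. Moreover: (i) $\mathrm{dBInf}_{G/1}^G$ is the identity map if we identify $G/1$ with $G$; and (ii) if $M$ is a normal subgroup of $G$ containing $N$, then \[\mathrm{dBInf}_{G/N}^G\circ \mathrm{dBInf}_{G/M}^{G/N}=\mathrm{dBInf}_{G/M}^G,\] where $G/M$ is identified canonically with $(G/N)/(M/N)$.
   Context: For finite groups $G,H$, a $(G,H)$-biset is a set with commuting left $G$-action and right $H$-action. $B(G,H)$ denotes the Grothendieck group of isomorphism classes of finite $(G,H)$-bisets with respect to disjoint union. For a $(G,H)$-biset $X$ and an $(H,K)$-biset $Y$, $X\times_H Y$ is the set of $H$-orbits of $X\times Y$ under $h\cdot(x,y)=(xh^{-1},hy)$, with its natural $(G,K)$-biset structure; this induces associative bilinear maps $\circ:B(G,H)\times B(H,K)\to B(G,K)$. The double Burnside ring of $G$ is $B(G,G)$ with multiplication $\circ$; its identity is $\mathrm{Id}_G=[G]$ ($G$ acting on itself by left and right multiplication). For $N\trianglelefteq G$, $\mathrm{Inf}_{G/N}^G\in B(G,G/N)$ is the class of the set $G/N$ with its natural $(G,G/N)$-action, and $\mathrm{Def}_{G/N}^G\in B(G/N,G)$ is the class of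 $G/N$ with its natural $(G/N,G)$-action. *)

(* Defs.v *)
From HB Require Import structures.
From mathcomp Require Import all_boot all_order all_algebra all_fingroup.
From mathcomp Require Import generic_quotient boolp.

Set Implicit Arguments.
Unset Strict Implicit.
Unset Printing Implicit Defensive.

Import GRing.Theory.

Local Open Scope quotient_scope.

(* A finite group is a [finGroupType]; [N] normal in the whole group gT reads
   [N <| [set: gT]], and then the type [coset_of N] is the group G/N. *)

Record bisetMixin (G H : finGroupType) (X : Type) := BisetMixin {
  lact_of : G -> X -> X;
  ract_of : X -> H -> X;
  lact1_of : forall x, lact_of 1%g x = x;
  lactM_of : forall g g' x, lact_of (g * g')%g x = lact_of g (lact_of g' x);
  ract1_of : forall x, ract_of x 1%g = x;
  ractM_of : forall x h h', ract_of x (h * h')%g = ract_of (ract_of x h) h';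
  lractA_of : forall g x h, ract_of (lact_of g x) h = lact_of g (ract_of x h)
}.

Record biset (G H : finGroupType) := Biset {
  bsort :> finType;
  bmixin : bisetMixin G H bsort
}.

Section BisetTheory.
Variables (G H : finGroupType).

Definition lact (X : biset G H) : G -> X -> X := lact_of (bmixin X).
Definition ract (X : biset G H) : X -> H -> X := ract_of (bmixin X).

Lemma lact1 (X : biset G H) (x : X) : lact 1 x = x.
Proof. exact: lact1_of. Qed.
Lemma lactM (X : biset G H) g g' (x : X) : lact (g * g') x = lact g (lact g' x).
Proof. exact: lactM_of. Qed.
Lemma ract1 (X : biset G H) (x : X) : ract x 1 = x.
Proof. exact: ract1_of. Qed.
Lemma ractM (X : biset G H) (x : X) h h' :
  ract x (h * h') = ract (ract x h) h'.
Proof. exact: ractM_of. Qed.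
Lemma lractA (X : biset G H) g (x : X) h :
  ract (lact g x) h = lact g (ract x h).
Proof. exact: lractA_of. Qed.
Lemma lactK (X : biset G H) g (x : X) : lact g^-1 (lact g x) = x.
Proof. by rewrite -lactM mulVg lact1. Qed.
Lemma lactKV (X : biset G H) g (x : X) : lact g (lact g^-1 x) = x.
Proof. by rewrite -lactM mulgV lact1. Qed.
Lemma ractK (X : biset G H) (x : X) h : ract (ract x h) h^-1 = x.
Proof. by rewrite -ractM mulgV ract1. Qed.
Lemma ractKV (X : biset G H) (x : X) h : ract (ract x h^-1) h = x.
Proof. by rewrite -ractM mulVg ract1. Qed.

Definition biset_iso (X Y : biset G H) : Prop :=
  exists f : X -> Y, [/\ bijective f,
    forall g x, f (lact g x) = lact g (f x) &
    forall x h, f (ract x h) = ract (f x) h].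

Lemma biset_iso_refl X : biset_iso X X.
Proof. by exists id; split=> //; exists id. Qed.

Lemma biset_iso_sym X Y : biset_iso X Y -> biset_iso Y X.
Proof.
case=> f [[f' fK f'K] fl fr]; exists f'; split; first by exists f.
  by move=> g y; rewrite -{1}(f'K y) -fl fK.
by move=> y h; rewrite -{1}(f'K y) -fr fK.
Qed.

Lemma biset_iso_trans X Y Z : biset_iso X Y -> biset_iso Y Z -> biset_iso X Z.
Proof.
case=> f [fb fl fr] [f' [fb' fl' fr']]; exists (f' \o f); split=> /=.
- exact: bij_comp.
- by move=> g x; rewrite fl fl'.
- by move=> x h; rewrite fr fr'.
Qed.

Lemma biset_iso_rel (X Y : biset G H) (R : X -> Y -> Prop) :
    (forall x, exists y, R x y) -> (forall y, exists x, R x y) ->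
    (forall x y x' y', R x y -> R x' y' -> x = x' <-> y = y') ->
    (forall g x y, R x y -> R (lact g x) (lact g y)) ->
    (forall h x y, R x y -> R (ract x h) (ract y h)) ->
  biset_iso X Y.
Proof.
move=> RX RY Rinj Rl Rr.
pose f x := projT1 (cid (RX x)); pose f' y := projT1 (cid (RY y)).
have fP x : R x (f x) by rewrite /f; case: cid.
have f'P y : R (f' y) y by rewrite /f'; case: cid.
exists f; split.
- exists f' => [x|y]; first by apply/(Rinj _ _ _ _ (f'P (f x)) (fP x)).
  by apply/(Rinj _ _ _ _ (fP (f' y)) (f'P y)).
- by move=> g x; apply/(Rinj _ _ _ _ (fP (lact g x)) (Rl g _ _ (fP x))).
- by move=> x h; apply/(Rinj _ _ _ _ (fP (ract x h)) (Rr h _ _ (fP x))).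
Qed.

Definition empty_biset : biset G H.
Proof. by exists void; exists (fun _ x => x) (fun x _ => x). Defined.

Section Sum.
Variables X Y : biset G H.

Definition sum_lact (g : G) (z : X + Y) : X + Y :=
  match z with inl x => inl (lact g x) | inr y => inr (lact g y) end.
Definition sum_ract (z : X + Y) (h : H) : X + Y :=
  match z with inl x => inl (ract x h) | inr y => inr (ract y h) end.

Definition sum_biset_mixin : bisetMixin G H (X + Y)%type.
Proof.
exists sum_lact sum_ract.
- by case=> z /=; rewrite lact1.
- by move=> g g' [] z /=; rewrite lactM.
- by case=> z /=; rewrite ract1.
- by move=> [] z h h' /=; rewrite ractM.
- by move=> g [] z h /=; rewrite lractA.
Defined.

Definition sum_biset : biset G H := Biset sum_biset_mixin.
End Sum.

End BisetTheory.

Lemma sum_biset_iso G H (X X' Y Y' : biset G H) :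
  biset_iso X X' -> biset_iso Y Y' ->
  biset_iso (sum_biset X Y) (sum_biset X' Y').
Proof.
case=> f [[f' fK f'K] fl fr] [e [[e' eK e'K] el er]].
exists (fun z : X + Y => match z with inl x => inl (f x) | inr y => inr (e y) end
        : sum_biset X' Y').
split.
- by exists (fun z : X' + Y' =>
    match z with inl x => inl (f' x) | inr y => inr (e' y) end) => -[] x;
    congr (_ _).
- by move=> g [] x; congr (_ _).
- by move=> [] x h; congr (_ _).
Qed.

Lemma sum_bisetC G H (X Y : biset G H) :
  biset_iso (sum_biset X Y) (sum_biset Y X).
Proof.
exists (fun z : X + Y => match z with inl x => inr x | inr y => inl y end
        : sum_biset Y X).
split; [|by move=> g []|by case].
by exists (fun z : Y + X => match z with inl x => inr x | inr y => inl y end);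
  case.
Qed.

Lemma sum_bisetA G H (X Y Z : biset G H) :
  biset_iso (sum_biset X (sum_biset Y Z)) (sum_biset (sum_biset X Y) Z).
Proof.
exists (fun t : X + (Y + Z) => match t with inl x => inl (inl x)
  | inr (inl y) => inl (inr y) | inr (inr z) => inr z end
  : sum_biset (sum_biset X Y) Z).
split; [|by move=> g [|[]]|by case=> [|[]]].
by exists (fun t : (X + Y) + Z => match t with inl (inl x) => inl x
  | inl (inr y) => inr (inl y) | inr z => inr (inr z) end); [case=> [|[]]|case=> [[]|]].
Qed.

Lemma sum_empty_biset G H (X : biset G H) :
  biset_iso (sum_biset (empty_biset G H) X) X.
Proof.
exists (fun t : void + X => match t with inl v => match v with end
        | inr x => x end).
split; [|by move=> g []|by case].
by exists (fun x => inr x) => // -[].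
Qed.

Definition id_biset_mixin (G : finGroupType) : bisetMixin G G G.
Proof.
exists (fun g x => g * x)%g (fun x g => x * g)%g => *;
  by rewrite ?mulg1 ?mul1g ?mulgA.
Defined.

Definition id_biset (G : finGroupType) : biset G G := Biset (id_biset_mixin G).

Section Restriction.
Variables (G G' H H' : finGroupType) (a : G' -> G) (b : H' -> H).
Hypotheses (aM : {morph a : x y / (x * y)%g}) (bM : {morph b : x y / (x * y)%g}).

Fact morph_id1 (K K' : finGroupType) (f : K' -> K) :
  {morph f : x y / (x * y)%g} -> f 1%g = 1%g.
Proof. by move=> fM; apply: (mulgI (f 1%g)); rewrite -fM !mulg1. Qed.

Definition res_biset_mixin (X : biset G H) : bisetMixin G' H' X.
Proof.
exists (fun g x => lact (a g) x) (fun x h => ract x (b h)).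
- by move=> x; rewrite (morph_id1 aM) lact1.
- by move=> g g' x; rewrite aM lactM.
- by move=> x; rewrite (morph_id1 bM) ract1.
- by move=> x h h'; rewrite bM ractM.
- by move=> g x h; rewrite lractA.
Defined.

Definition res_biset (X : biset G H) : biset G' H' := Biset (res_biset_mixin X).

End Restriction.

Section RestrictionTheory.
Variables (G G' H H' : finGroupType) (a : G' -> G) (b : H' -> H).
Hypotheses (aM : {morph a : x y / (x * y)%g}) (bM : {morph b : x y / (x * y)%g}).

Lemma res_biset_iso (X Y : biset G H) :
  biset_iso X Y -> biset_iso (res_biset aM bM X) (res_biset aM bM Y).
Proof.
case=> f [fb fl fr]; exists f; split; first exact: fb.
  by move=> g x; apply: (fl (a g)).
by move=> x h; apply: fr.
Qed.

Lemma res_biset_sum (X Y : biset G H) :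
  biset_iso (res_biset aM bM (sum_biset X Y))
            (sum_biset (res_biset aM bM X) (res_biset aM bM Y)).
Proof. by exists id; split; [exists id | move=> g [] | case]. Qed.

End RestrictionTheory.

Section Tensor.
Variables (G H K : finGroupType) (X : biset G H) (Y : biset H K).
Implicit Types (p q : X * Y).

(* The carrier of [tens_biset X Y] is the set of orbits of H on X * Y, each orbit
   being a {set X * Y}; G and K act on orbits elementwise. *)
Definition tens_act (h : H) p : X * Y := (ract p.1 h^-1, lact h p.2).
Definition tens_orbit p : {set X * Y} := [set tens_act h p | h : H].
Definition tens_orbits : {set {set X * Y}} := [set tens_orbit p | p : X * Y].
Definition tens_sort : finType := {A : {set X * Y} | A \in tens_orbits}.

Definition tlmap (g : G) p : X * Y := (lact g p.1, p.2).
Definition trmap (k : K) p : X * Y := (p.1, ract p.2 k).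

Lemma tlmap_orbit g p : tlmap g @: tens_orbit p = tens_orbit (tlmap g p).
Proof.
rewrite /tens_orbit -imset_comp; apply: eq_imset => h.
by rewrite /tlmap /tens_act /= lractA.
Qed.

Lemma trmap_orbit k p : trmap k @: tens_orbit p = tens_orbit (trmap k p).
Proof.
rewrite /tens_orbit -imset_comp; apply: eq_imset => h.
by rewrite /trmap /tens_act /= lractA.
Qed.

Fact tens_lact_subproof g (A : tens_sort) : tlmap g @: val A \in tens_orbits.
Proof.
by case: A => A /= /imsetP[p _ ->]; rewrite tlmap_orbit imset_f.
Qed.

Fact tens_ract_subproof k (A : tens_sort) : trmap k @: val A \in tens_orbits.
Proof.
by case: A => A /= /imsetP[p _ ->]; rewrite trmap_orbit imset_f.
Qed.

Definition tens_lact g A : tens_sort := exist (fun A => A \in tens_orbits) _ (tens_lact_subproof g A).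
Definition tens_ract A k : tens_sort := exist (fun A => A \in tens_orbits) _ (tens_ract_subproof k A).

Definition tens_biset_mixin : bisetMixin G K tens_sort.
Proof.
exists tens_lact tens_ract.
- by move=> A; apply: val_inj => /=; rewrite -[RHS]imset_id;
    apply: eq_imset => -[x y]; rewrite /tlmap lact1.
- by move=> g g' A; apply: val_inj => /=; rewrite -imset_comp;
    apply: eq_imset => -[x y]; rewrite /tlmap lactM.
- by move=> A; apply: val_inj => /=; rewrite -[RHS]imset_id;
    apply: eq_imset => -[x y]; rewrite /trmap ract1.
- by move=> A g g'; apply: val_inj => /=; rewrite -imset_comp;
    apply: eq_imset => -[x y]; rewrite /trmap ractM.
- by move=> g A h; apply: val_inj => /=; rewrite -!imset_comp;
    apply: eq_imset => -[x y].
Defined.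

Definition tens_biset : biset G K := Biset tens_biset_mixin.

Fact tens_orbit_subproof p : tens_orbit p \in tens_orbits.
Proof. exact: imset_f. Qed.

Definition tens_pi p : tens_biset :=
  exist (fun A => A \in tens_orbits) (tens_orbit p) (tens_orbit_subproof p).

Lemma tens_pi_surj (A : tens_biset) : exists p, A = tens_pi p.
Proof. by case: A => A oA; have /imsetP[p _ eA] := oA; exists p; apply: val_inj. Qed.

Lemma tens_act1 p : tens_act 1 p = p.
Proof. by case: p => x y; rewrite /tens_act invg1 ract1 lact1. Qed.

Lemma tens_actM h h' p : tens_act (h * h') p = tens_act h (tens_act h' p).
Proof. by rewrite /tens_act /= invMg ractM lactM. Qed.

Lemma tens_piE p q : tens_pi p = tens_pi q <-> exists h, q = tens_act h p.
Proof.
split=> [/(congr1 val)/= epq | [h ->]].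
  have /imsetP[h _ eq] : q \in tens_orbit p.
    by rewrite epq; apply/imsetP; exists 1%g => //; rewrite tens_act1.
  by exists h.
apply: val_inj; apply/setP=> r; apply/imsetP/imsetP=> -[k _ ->].
  by exists (k * h^-1)%g => //; rewrite -tens_actM mulgKV.
by exists (k * h)%g => //; rewrite tens_actM.
Qed.

Lemma tens_pi_pairE x y x' y' : tens_pi (x, y) = tens_pi (x', y') <->
  exists h, x' = ract x h^-1 /\ y' = lact h y.
Proof.
split=> [/tens_piE[h [-> ->]] | [h [-> ->]]]; first by exists h.
by apply/tens_piE; exists h.
Qed.

Lemma tens_pi_act h p : tens_pi (tens_act h p) = tens_pi p.
Proof. by apply/esym/tens_piE; exists h. Qed.

Lemma lact_tens_pi g p : lact g (tens_pi p) = tens_pi (lact g p.1, p.2).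
Proof. by apply: val_inj; apply: tlmap_orbit. Qed.

Lemma ract_tens_pi p k : ract (tens_pi p) k = tens_pi (p.1, ract p.2 k).
Proof. by apply: val_inj; apply: trmap_orbit. Qed.

End Tensor.

Lemma tens_biset_iso G H K (X X' : biset G H) (Y Y' : biset H K) :
  biset_iso X X' -> biset_iso Y Y' ->
  biset_iso (tens_biset X Y) (tens_biset X' Y').
Proof.
case=> f [[f' fK f'K] fl fr] [e [[e' eK e'K] el er]].
pose F (p : X * Y) := (f p.1, e p.2).
apply: (@biset_iso_rel _ _ _ _
  (fun A B => exists p, A = tens_pi p /\ B = tens_pi (F p))).
- by move=> A; have [p ->] := tens_pi_surj A; exists (tens_pi (F p)), p.
- move=> B; have [[x y] ->] := tens_pi_surj B.
  by exists (tens_pi (f' x, e' y)), (f' x, e' y); rewrite /F /= f'K e'K.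
- move=> _ _ _ _ [p [-> ->]] [q [-> ->]].
  split=> /tens_piE[h E]; apply/tens_piE; exists h.
    by rewrite E /F /tens_act /= fr el.
  case: p q E => [x y] [x' y'] [] /=; rewrite /tens_act /= -fr -el => ex ey.
  by rewrite (can_inj fK ex) (can_inj eK ey).
- move=> g _ _ [p [-> ->]]; exists (lact g p.1, p.2).
  by rewrite !lact_tens_pi /F /= fl.
- move=> k _ _ [p [-> ->]]; exists (p.1, ract p.2 k).
  by rewrite !ract_tens_pi /F /= er.
Qed.

Lemma tens_biset_suml G H K (X X' : biset G H) (Y : biset H K) :
  biset_iso (tens_biset (sum_biset X X') Y)
            (sum_biset (tens_biset X Y) (tens_biset X' Y)).
Proof.
pose F (p : sum_biset X X' * Y) : sum_biset (tens_biset X Y) (tens_biset X' Y) :=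
  match p with (inl x, y) => inl (tens_pi (x, y))
             | (inr x, y) => inr (tens_pi (x, y)) end.
apply: (@biset_iso_rel _ _ _ _
  (fun A B => exists p, A = tens_pi p /\ B = F p)).
- by move=> A; have [p ->] := tens_pi_surj A; exists (F p), p.
- case=> B; have [[x y] ->] := tens_pi_surj B.
    by exists (tens_pi (inl x : sum_biset X X', y)), (inl x, y).
  by exists (tens_pi (inr x : sum_biset X X', y)), (inr x, y).
- move=> _ _ _ _ [p [-> ->]] [q [-> ->]]; split.
    move/tens_piE=> [h ->]; case: p => [[x|x] y] /=;
    [congr inl | congr inr]; by apply/tens_piE; exists h.
  case: p q => [[x|x] y] [[x'|x'] y'] //= [] E.
    have /tens_piE[h [-> ->]] : tens_pi (x, y) = tens_pi (x', y') by apply: val_inj.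
    exact/esym/(@tens_pi_act _ _ _ (sum_biset X X') Y h (inl x, y)).
  have /tens_piE[h [-> ->]] : tens_pi (x, y) = tens_pi (x', y') by apply: val_inj.
  exact/esym/(@tens_pi_act _ _ _ (sum_biset X X') Y h (inr x, y)).
- move=> g _ _ [p [-> ->]]; exists (lact g p.1, p.2); rewrite lact_tens_pi; split=> //.
  by case: p => [[x|x] y] /=; rewrite -[LHS]/(_ (lact g (tens_pi _))) lact_tens_pi.
- move=> k _ _ [p [-> ->]]; exists (p.1, ract p.2 k); rewrite ract_tens_pi; split=> //.
  by case: p => [[x|x] y] /=; rewrite -[LHS]/(_ (ract (tens_pi _) k)) ract_tens_pi.
Qed.

Lemma tens_biset_sumr G H K (X : biset G H) (Y Y' : biset H K) :
  biset_iso (tens_biset X (sum_biset Y Y'))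
            (sum_biset (tens_biset X Y) (tens_biset X Y')).
Proof.
pose F (p : X * sum_biset Y Y') : sum_biset (tens_biset X Y) (tens_biset X Y') :=
  match p with (x, inl y) => inl (tens_pi (x, y))
             | (x, inr y) => inr (tens_pi (x, y)) end.
apply: (@biset_iso_rel _ _ _ _
  (fun A B => exists p, A = tens_pi p /\ B = F p)).
- by move=> A; have [p ->] := tens_pi_surj A; exists (F p), p.
- case=> B; have [[x y] ->] := tens_pi_surj B.
    by exists (tens_pi (x, inl y : sum_biset Y Y')), (x, inl y).
  by exists (tens_pi (x, inr y : sum_biset Y Y')), (x, inr y).
- move=> _ _ _ _ [p [-> ->]] [q [-> ->]]; split.
    move/tens_piE=> [h ->]; case: p => [x [y|y]] /=;
    [congr inl | congr inr]; by apply/tens_piE; exists h.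
  case: p q => [x [y|y]] [x' [y'|y']] //= [] E.
    have /tens_piE[h [-> ->]] : tens_pi (x, y) = tens_pi (x', y') by apply: val_inj.
    exact/esym/(@tens_pi_act _ _ _ X (sum_biset Y Y') h (x, inl y)).
  have /tens_piE[h [-> ->]] : tens_pi (x, y) = tens_pi (x', y') by apply: val_inj.
  exact/esym/(@tens_pi_act _ _ _ X (sum_biset Y Y') h (x, inr y)).
- move=> g _ _ [p [-> ->]]; exists (lact g p.1, p.2); rewrite lact_tens_pi; split=> //.
  by case: p => [x [y|y]] /=; rewrite -[LHS]/(_ (lact g (tens_pi _))) lact_tens_pi.
- move=> k _ _ [p [-> ->]]; exists (p.1, ract p.2 k); rewrite ract_tens_pi; split=> //.
  by case: p => [x [y|y]] /=; rewrite -[LHS]/(_ (ract (tens_pi _) k)) ract_tens_pi.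
Qed.

Lemma tens_bisetA G H K L (X : biset G H) (Y : biset H K) (Z : biset K L) :
  biset_iso (tens_biset X (tens_biset Y Z)) (tens_biset (tens_biset X Y) Z).
Proof.
apply: (@biset_iso_rel _ _ _ _ (fun A B => exists x y z,
  A = tens_pi (x, tens_pi (y, z)) /\ B = tens_pi (tens_pi (x, y), z))).
- move=> A; have [[x B] ->] := tens_pi_surj A; have [[y z] ->] := tens_pi_surj B.
  by exists (tens_pi (tens_pi (x, y), z)), x, y, z.
- move=> A; have [[B z] ->] := tens_pi_surj A; have [[x y] ->] := tens_pi_surj B.
  by exists (tens_pi (x, tens_pi (y, z))), x, y, z.
- move=> _ _ _ _ [x [y [z [-> ->]]]] [x' [y' [z' [-> ->]]]]; split.
    case/tens_pi_pairE=> h [-> +]; rewrite lact_tens_pi.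
    case/esym/tens_pi_pairE=> k [/= -> ->].
    apply/(@tens_pi_pairE _ _ _ (tens_biset X Y) Z).
    exists k; split=> //; rewrite ract_tens_pi; apply/tens_pi_pairE.
    by exists h^-1%g; rewrite invgK ractKV -lractA lactK.
  case/tens_pi_pairE=> k [+ ->]; rewrite ract_tens_pi.
  case/esym/tens_pi_pairE=> h [/= -> ->].
  apply/(@tens_pi_pairE _ _ _ X (tens_biset Y Z)).
  exists h; split=> //; rewrite lact_tens_pi; apply/tens_pi_pairE.
  by exists k^-1%g; rewrite invgK lractA ractKV lactK.
- move=> g _ _ [x [y [z [-> ->]]]]; exists (lact g x), y, z.
  by rewrite !lact_tens_pi.
- move=> g _ _ [x [y [z [-> ->]]]]; exists x, y, (ract z g).
  by rewrite !ract_tens_pi.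
Qed.

Lemma tens_id_bisetl G H (X : biset G H) :
  biset_iso (tens_biset (id_biset G) X) X.
Proof.
apply: (@biset_iso_rel _ _ _ _
  (fun A x => exists p : id_biset G * X, A = tens_pi p /\ x = lact p.1 p.2)).
- by move=> A; have [p ->] := tens_pi_surj A; exists (lact p.1 p.2), p.
- by move=> x; exists (tens_pi (1%g : id_biset G, x)), (1%g, x); rewrite lact1.
- move=> _ _ _ _ [[a x] [-> ->]] [[b y] [-> ->]] /=; split.
    case/(@tens_pi_pairE _ _ _ (id_biset G) X)=> h [-> ->] /=; rewrite -lactM /ract /=.
    by rewrite mulgKV.
  move=> E; apply/(@tens_pi_pairE _ _ _ (id_biset G) X); exists (b^-1 * a)%g; split.
    by rewrite /ract /= invMg invgK mulgA mulgV mul1g.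
  by rewrite /= lactM E lactK.
- move=> g _ _ [p [-> ->]]; exists ((g * (p.1 : G))%g, p.2).
  by rewrite lact_tens_pi lactM.
- move=> g _ _ [p [-> ->]]; exists (p.1, ract p.2 g).
  by rewrite ract_tens_pi lractA.
Qed.

Lemma tens_id_bisetr G H (X : biset G H) :
  biset_iso (tens_biset X (id_biset H)) X.
Proof.
apply: (@biset_iso_rel _ _ _ _
  (fun A x => exists p : X * id_biset H, A = tens_pi p /\ x = ract p.1 p.2)).
- by move=> A; have [p ->] := tens_pi_surj A; exists (ract p.1 p.2), p.
- by move=> x; exists (tens_pi (x, 1%g : id_biset H)), (x, 1%g); rewrite ract1.
- move=> _ _ _ _ [[x a] [-> ->]] [[y b] [-> ->]] /=; split.
    case/(@tens_pi_pairE _ _ _ X (id_biset H))=> h [-> ->] /=; rewrite -ractM /lact /=.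
    by rewrite mulKg.
  move=> E; apply/(@tens_pi_pairE _ _ _ X (id_biset H)); exists (b * a^-1)%g; split.
    by rewrite /= invMg invgK ractM E ractK.
  by rewrite /lact /= mulgKV.
- move=> g _ _ [p [-> ->]]; exists (lact g p.1, p.2).
  by rewrite lact_tens_pi lractA.
- move=> g _ _ [p [-> ->]]; exists (p.1, ((p.2 : H) * g)%g).
  by rewrite ract_tens_pi ractM.
Qed.

(* The type [biset G H] lives in too large a universe to carry a choiceType
   structure, so isomorphism classes are formed from the bisets on the sets 'I_n;
   every finite biset X has the isomorphic copy [std_biset X] among these, and
   [class_ofE] shows that this gives exactly the isomorphism classes. *)
Record ord_biset (G H : finGroupType) := OrdBiset {
  ord_size : nat;
  ord_mixin : bisetMixin G H 'I_ord_size
}.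

HB.instance Definition _ G H := gen_eqMixin (ord_biset G H).
HB.instance Definition _ G H := gen_choiceMixin (ord_biset G H).

Coercion biset_of_ord G H (s : ord_biset G H) : biset G H :=
  Biset (ord_mixin s).

Section Std.
Variables (G H : finGroupType) (X : biset G H).

Definition std_biset_mixin : bisetMixin G H 'I_#|X|.
Proof.
exists (fun g i => enum_rank (lact g (enum_val i)))
       (fun i h => enum_rank (ract (enum_val i) h)) => *.
- by rewrite lact1 enum_valK.
- by rewrite enum_rankK lactM.
- by rewrite ract1 enum_valK.
- by rewrite enum_rankK ractM.
- by rewrite !enum_rankK lractA.
Defined.

Definition std_biset : ord_biset G H := OrdBiset std_biset_mixin.

Lemma std_biset_iso : biset_iso X std_biset.
Proof.
exists (@enum_rank X); split; first exact: enum_rank_bij.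
  by move=> g x; rewrite -{1}(enum_rankK x).
by move=> x h; rewrite -{1}(enum_rankK x).
Qed.

End Std.

Section IsoClasses.
Variables G H : finGroupType.

Definition ord_biset_iso (s t : ord_biset G H) : bool := `[< biset_iso s t >].

Fact ord_biset_iso_refl : reflexive ord_biset_iso.
Proof. by move=> s; apply/asboolP/biset_iso_refl. Qed.
Fact ord_biset_iso_sym : symmetric ord_biset_iso.
Proof. by move=> s t; apply/asboolP/asboolP=> /biset_iso_sym. Qed.
Fact ord_biset_iso_trans : transitive ord_biset_iso.
Proof.
move=> t s u /asboolP st /asboolP tu; apply/asboolP.
exact: biset_iso_trans st tu.
Qed.

Canonical ord_biset_iso_equiv := EquivRel ord_biset_iso
  ord_biset_iso_refl ord_biset_iso_sym ord_biset_iso_trans.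

Definition isoclass : Type := {eq_quot ord_biset_iso}.
HB.instance Definition _ := Choice.on isoclass.
HB.instance Definition _ : EqQuotient _ ord_biset_iso isoclass :=
  EqQuotient.on isoclass.

Definition class_of (X : biset G H) : isoclass := \pi_isoclass (std_biset X).

Lemma class_ofE X Y : class_of X = class_of Y <-> biset_iso X Y.
Proof.
have [iX iY] := (std_biset_iso X, std_biset_iso Y).
split=> [/eqP | iXY]; rewrite /class_of.
  rewrite eqmodE => /asboolP iXY.
  exact: biset_iso_trans iX (biset_iso_trans iXY (biset_iso_sym iY)).
apply/eqP; rewrite eqmodE; apply/asboolP.
exact: biset_iso_trans (biset_iso_sym iX) (biset_iso_trans iXY iY).
Qed.

Definition class_rep (c : isoclass) : biset G H := repr c.

Lemma class_repK c : class_of (class_rep c) = c.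
Proof.
rewrite -[RHS]reprK; apply/eqP; rewrite eqmodE.
by apply/asboolP/biset_iso_sym/std_biset_iso.
Qed.

Lemma class_repP X : biset_iso (class_rep (class_of X)) X.
Proof. by apply/class_ofE; rewrite class_repK. Qed.

Definition isoclass0 : isoclass := class_of (empty_biset G H).
Definition isoclass_add (c d : isoclass) : isoclass :=
  class_of (sum_biset (class_rep c) (class_rep d)).

Lemma isoclass_addE X Y :
  isoclass_add (class_of X) (class_of Y) = class_of (sum_biset X Y).
Proof. by apply/class_ofE/sum_biset_iso; apply: class_repP. Qed.

Fact isoclass_addA : associative isoclass_add.
Proof.
move=> c d e; rewrite -(class_repK c) -(class_repK d) -(class_repK e).
by rewrite !isoclass_addE; apply/class_ofE/sum_bisetA.
Qed.

Fact isoclass_addC : commutative isoclass_add.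
Proof. by move=> c d; apply/class_ofE/sum_bisetC. Qed.

Fact isoclass_add0 : left_id isoclass0 isoclass_add.
Proof.
move=> c; rewrite -(class_repK c) isoclass_addE.
exact/class_ofE/sum_empty_biset.
Qed.

HB.instance Definition _ :=
  GRing.isNmodule.Build isoclass isoclass_addA isoclass_addC isoclass_add0.

End IsoClasses.

Local Open Scope ring_scope.

Lemma class_of_sum G H (X Y : biset G H) :
  class_of (sum_biset X Y) = class_of X + class_of Y.
Proof. by rewrite -isoclass_addE. Qed.

Definition isoclass_mul G H K (c : isoclass G H) (d : isoclass H K) :=
  class_of (tens_biset (class_rep c) (class_rep d)).

Lemma isoclass_mulE G H K (X : biset G H) (Y : biset H K) :
  isoclass_mul (class_of X) (class_of Y) = class_of (tens_biset X Y).
Proof. by apply/class_ofE/tens_biset_iso; apply: class_repP. Qed.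

Lemma isoclass_mulDl G H K (d : isoclass H K) :
  {morph (@isoclass_mul G H K)^~ d : c c' / c + c'}.
Proof.
move=> c c' /=; rewrite -(class_repK c) -(class_repK c') -(class_repK d).
by rewrite -class_of_sum !isoclass_mulE -class_of_sum; apply/class_ofE/tens_biset_suml.
Qed.

Lemma isoclass_mulDr G H K (c : isoclass G H) :
  {morph (@isoclass_mul G H K) c : d d' / d + d'}.
Proof.
move=> d d' /=; rewrite -(class_repK c) -(class_repK d') -(class_repK d).
by rewrite -class_of_sum !isoclass_mulE -class_of_sum; apply/class_ofE/tens_biset_sumr.
Qed.

Definition isoclass_res (G G' H H' : finGroupType) (a : G' -> G) (b : H' -> H)
    (aM : {morph a : x y / (x * y)%g}) (bM : {morph b : x y / (x * y)%g})
    (c : isoclass G H) : isoclass G' H' :=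
  class_of (res_biset aM bM (class_rep c)).

Lemma isoclass_resE (G G' H H' : finGroupType) (a : G' -> G) (b : H' -> H)
    (aM : {morph a : x y / (x * y)%g}) (bM : {morph b : x y / (x * y)%g})
    (X : biset G H) :
  isoclass_res aM bM (class_of X) = class_of (res_biset aM bM X).
Proof. exact/class_ofE/res_biset_iso/class_repP. Qed.

Section Grothendieck.
Variable M : nmodType.
Implicit Types p q : M * M.

Definition groth_rel p q : bool :=
  `[< exists m, p.1 + q.2 + m = q.1 + p.2 + m >].

Fact groth_rel_refl : reflexive groth_rel.
Proof. by move=> p; apply/asboolP; exists 0. Qed.
Fact groth_rel_sym : symmetric groth_rel.
Proof. by move=> p q; apply/asboolP/asboolP=> -[m E]; exists m. Qed.
Fact groth_rel_trans : transitive groth_rel.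
Proof.
move=> q p r /asboolP[m pq] /asboolP[n qr]; apply/asboolP.
have : p.1 + q.2 + m + (q.1 + r.2 + n) = q.1 + p.2 + m + (r.1 + q.2 + n).
  by rewrite pq qr.
rewrite !addrA => E; exists (q.2 + m + q.1 + n); rewrite !addrA.
by rewrite [LHS](ACl (1*3*4*5*2*6))/= [RHS](ACl (5*2*4*1*3*6))/=.
Qed.

Canonical groth_equiv := EquivRel groth_rel
  groth_rel_refl groth_rel_sym groth_rel_trans.

Definition groth : Type := {eq_quot groth_rel}.
HB.instance Definition _ := Choice.on groth.
HB.instance Definition _ : EqQuotient _ groth_rel groth := EqQuotient.on groth.

Definition groth_pi p : groth := \pi_groth p.

Lemma groth_piE p q :
  groth_pi p = groth_pi q <-> exists m, p.1 + q.2 + m = q.1 + p.2 + m.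
Proof.
rewrite /groth_pi; split=> [/eqP | pq]; first by rewrite eqmodE => /asboolP.
by apply/eqP; rewrite eqmodE; apply/asboolP.
Qed.

Lemma groth_piK (x : groth) : groth_pi (repr x) = x.
Proof. exact: reprK. Qed.

Lemma groth_reprP p :
  exists m, (repr (groth_pi p)).1 + p.2 + m = p.1 + (repr (groth_pi p)).2 + m.
Proof. by apply/groth_piE; rewrite groth_piK. Qed.

Definition groth_opp (x : groth) : groth := groth_pi ((repr x).2, (repr x).1).
Definition groth_add (x y : groth) : groth :=
  groth_pi ((repr x).1 + (repr y).1, (repr x).2 + (repr y).2).

Lemma groth_oppE p : groth_opp (groth_pi p) = groth_pi (p.2, p.1).
Proof.
have [m E] := groth_reprP p; apply/groth_piE; exists m => /=.
by rewrite [_ + p.1]addrC -E [p.2 + _]addrC.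
Qed.

Lemma groth_addE p q :
  groth_add (groth_pi p) (groth_pi q) = groth_pi (p.1 + q.1, p.2 + q.2).
Proof.
have [m E] := groth_reprP p; have [n E'] := groth_reprP q.
apply/groth_piE; exists (m + n) => /=.
rewrite [X in X + _]addrACA addrACA E E' addrACA.
by rewrite [X in X + _]addrACA.
Qed.

Fact groth_addA : associative groth_add.
Proof.
move=> x y z; rewrite -(groth_piK x) -(groth_piK y) -(groth_piK z).
by rewrite !groth_addE /= !addrA.
Qed.
Fact groth_addC : commutative groth_add.
Proof. by move=> x y; rewrite /groth_add addrC [X in (_, X)]addrC. Qed.
Fact groth_add0 : left_id (groth_pi (0, 0)) groth_add.
Proof.
move=> x; rewrite -(groth_piK x) groth_addE /= !add0r.
by rewrite -surjective_pairing.
Qed.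
Fact groth_addN : left_inverse (groth_pi (0, 0)) groth_opp groth_add.
Proof.
move=> x; rewrite -(groth_piK x) groth_oppE groth_addE; apply/groth_piE.
by exists 0; rewrite /= !addr0 add0r addrC.
Qed.

HB.instance Definition _ := GRing.isZmodule.Build groth
  groth_addA groth_addC groth_add0 groth_addN.

Definition groth_inj (m : M) : groth := groth_pi (m, 0).

Lemma groth_injD : {morph groth_inj : m n / m + n}.
Proof. by move=> m n; rewrite [RHS]groth_addE /= addr0. Qed.

Lemma groth_pi_sub p : groth_pi p = groth_inj p.1 - groth_inj p.2.
Proof.
rewrite [RHS](_ : _ = groth_add (groth_inj p.1) (groth_opp (groth_inj p.2))) //.
by rewrite groth_oppE groth_addE /= addr0 add0r -surjective_pairing.
Qed.

Lemma groth_reprE (x : groth) :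
  x = groth_inj (repr x).1 - groth_inj (repr x).2.
Proof. by rewrite -groth_pi_sub groth_piK. Qed.

Lemma groth_injE m n : groth_inj m = groth_inj n <-> exists k, m + k = n + k.
Proof.
split=> [/groth_piE[k /=]|[k E]]; first by rewrite !addr0; exists k.
by apply/groth_piE; exists k; rewrite /= !addr0.
Qed.

End Grothendieck.

Lemma groth_ind (M : nmodType) (P : groth M -> Prop) :
    (forall m, P (groth_inj m)) -> (forall x y, P x -> P y -> P (x - y)) ->
  forall x, P x.
Proof. by move=> Pi PB x; rewrite [x]groth_reprE; apply: PB. Qed.

(* For additive f, the unique additive extension of f to [groth M]. *)
Definition groth_lift (M : nmodType) (A : zmodType) (f : M -> A)
  (x : groth M) : A := f (repr x).1 - f (repr x).2.

Section GrothLift.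
Variables (M : nmodType) (A : zmodType) (f : M -> A).
Hypothesis fD : {morph f : m n / m + n}.

Lemma groth_lift_pi p : groth_lift f (groth_pi p) = f p.1 - f p.2.
Proof.
have [m /(congr1 f)] := groth_reprP p; rewrite !fD => /addIr E.
by apply/eqP; rewrite /groth_lift subr_eq addrAC eq_sym subr_eq E.
Qed.

Lemma groth_lift_inj m : groth_lift f (groth_inj m) = f m.
Proof.
rewrite groth_lift_pi /=; have /eqP := fD 0 0.
by rewrite addr0 eq_sym -subr_eq0 addrK => /eqP ->; rewrite subr0.
Qed.

Lemma groth_liftD : {morph groth_lift f : x y / x + y}.
Proof.
move=> x y; rewrite -(groth_piK x) -(groth_piK y).
rewrite [X in groth_lift _ X]groth_addE !groth_lift_pi /= !fD opprD.
by rewrite addrACA.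
Qed.

Lemma groth_liftB : {morph groth_lift f : x y / x - y}.
Proof.
move=> x y; apply/eqP; rewrite eq_sym subr_eq -groth_liftD subrK.
by [].
Qed.

End GrothLift.

Definition B (G H : finGroupType) : Type := groth (isoclass G H).
HB.instance Definition _ G H := GRing.Zmodule.on (B G H).

Definition bcl G H (X : biset G H) : B G H := groth_inj (class_of X).

Lemma bcl_sum G H (X Y : biset G H) : bcl (sum_biset X Y) = bcl X + bcl Y.
Proof. by rewrite /bcl class_of_sum; apply: groth_injD. Qed.

Lemma bclE G H (X Y : biset G H) : bcl X = bcl Y <->
  exists Z : biset G H, biset_iso (sum_biset X Z) (sum_biset Y Z).
Proof.
split=> [/groth_injE[c]|[Z /class_ofE]].
  by rewrite -(class_repK c) -!class_of_sum => /class_ofE; exists (class_rep c).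
by rewrite !class_of_sum => E; apply/groth_injE; exists (class_of Z).
Qed.

Lemma bcl_iso G H (X Y : biset G H) : biset_iso X Y -> bcl X = bcl Y.
Proof. by move/class_ofE; rewrite /bcl => ->. Qed.

Lemma B_ind G H (P : B G H -> Prop) :
    (forall X, P (bcl X)) -> (forall x y, P x -> P y -> P (x - y)) ->
  forall x, P x.
Proof.
by move=> PX PB; apply: groth_ind => // c; rewrite -(class_repK c); apply: PX.
Qed.

HB.lock Definition circ (G H K : finGroupType) (u : B G H) (v : B H K) : B G K :=
  groth_lift (fun c =>
    groth_lift (fun d => groth_inj (isoclass_mul c d)) v) u.

Canonical circ_unlockable := Unlockable circ.unlock.

Notation "u \oB v" := (circ u v) (at level 40, left associativity).

Section Circ.
Variables G H K : finGroupType.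

Fact circ_subproof_r (c : isoclass G H) :
  {morph (fun d : isoclass H K => groth_inj (isoclass_mul c d)) : d d' / d + d'}.
Proof. by move=> d d'; rewrite isoclass_mulDr groth_injD. Qed.

Fact circ_subproof_l (v : B H K) :
  {morph (fun c : isoclass G H =>
    groth_lift (fun d => groth_inj (isoclass_mul c d)) v) : c c' / c + c'}.
Proof.
move=> c c'; rewrite /groth_lift !isoclass_mulDl !groth_injD opprD.
by rewrite addrACA.
Qed.

Lemma circE (X : biset G H) (Y : biset H K) :
  bcl X \oB bcl Y = bcl (tens_biset X Y).
Proof.
rewrite unlock groth_lift_inj; last exact: circ_subproof_l.
by rewrite groth_lift_inj ?isoclass_mulE //; apply: circ_subproof_r.
Qed.

Lemma circDl (v : B H K) (x y : B G H) : (x + y) \oB v = x \oB v + y \oB v.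
Proof. rewrite unlock; exact: groth_liftD (@circ_subproof_l v) x y. Qed.
Lemma circBl (v : B H K) (x y : B G H) : (x - y) \oB v = x \oB v - y \oB v.
Proof. rewrite unlock; exact: groth_liftB (@circ_subproof_l v) x y. Qed.

Lemma circDr (u : B G H) (x y : B H K) : u \oB (x + y) = u \oB x + u \oB y.
Proof.
rewrite unlock {1 3 5}/groth_lift.
by rewrite !(groth_liftD (@circ_subproof_r _)) opprD addrACA.
Qed.
Lemma circBr (u : B G H) (x y : B H K) : u \oB (x - y) = u \oB x - u \oB y.
Proof.
by apply/eqP; rewrite eq_sym subr_eq -circDr subrK.
Qed.

End Circ.

Lemma circA G H K L (u : B G H) (v : B H K) (w : B K L) :
  u \oB (v \oB w) = u \oB v \oB w.
Proof.
elim/B_ind: u => [X|x y Ex Ey]; last by rewrite !circBl Ex Ey.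
elim/B_ind: v => [Y|x y Ex Ey]; last by rewrite circBl !circBr circBl Ex Ey.
elim/B_ind: w => [Z|x y Ex Ey]; last by rewrite !circBr Ex Ey.
by rewrite !circE; apply/bcl_iso/tens_bisetA.
Qed.

Definition IdB (G : finGroupType) : B G G := bcl (id_biset G).

Lemma circ1l G H (u : B G H) : IdB G \oB u = u.
Proof.
elim/B_ind: u => [X|x y Ex Ey]; last by rewrite circBr Ex Ey.
by rewrite circE; apply/bcl_iso/tens_id_bisetl.
Qed.

Lemma circ1r G H (u : B G H) : u \oB IdB H = u.
Proof.
elim/B_ind: u => [X|x y Ex Ey]; last by rewrite circBl Ex Ey.
by rewrite circE; apply/bcl_iso/tens_id_bisetr.
Qed.

Lemma IdB_neq0 (G : finGroupType) : IdB G != 0.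
Proof.
apply/eqP=> /groth_injE[c].
rewrite add0r -(class_repK c) -class_of_sum => /class_ofE[f [/bij_eq_card E _ _]].
move/eqP: E; rewrite card_sum -[X in _ == X]add0n eqn_add2r => /eqP/card0_eq.
by move/(_ 1%g).
Qed.

HB.instance Definition _ (G : finGroupType) :=
  GRing.Zmodule_isNzRing.Build (B G G)
    (@circA G G G G) (@circ1l G G) (@circ1r G G)
    (fun x y z => @circDl G G G z x y) (@circDr G G G) (IdB_neq0 G).

Section DoubleBurnsideUnits.
Variable G : finGroupType.

Definition dB_unit : pred (B G G) :=
  fun u => `[< exists v, v * u = 1 /\ u * v = 1 >].

Definition dB_inv (u : B G G) : B G G :=
  if pselect (exists v, v * u = 1 /\ u * v = 1) is left uP
  then projT1 (cid uP) else u.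

Fact dB_mulVr : {in dB_unit, left_inverse 1 dB_inv *%R}.
Proof.
move=> u /asboolP uP; rewrite /dB_inv; case: pselect => // uP'.
by case: cid => v /= [].
Qed.
Fact dB_divrr : {in dB_unit, right_inverse 1 dB_inv *%R}.
Proof.
move=> u /asboolP uP; rewrite /dB_inv; case: pselect => // uP'.
by case: cid => v /= [].
Qed.
Fact dB_unitP (u v : B G G) : v * u = 1 /\ u * v = 1 -> dB_unit u.
Proof. by move=> uv; apply/asboolP; exists v. Qed.
Fact dB_inv_out : {in [predC dB_unit], dB_inv =1 id}.
Proof.
move=> u; rewrite inE /= => /asboolP uP; rewrite /dB_inv.
by case: pselect.
Qed.

HB.instance Definition _ := GRing.NzRing_hasMulInverse.Build (B G G)
  dB_mulVr dB_divrr dB_unitP dB_inv_out.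

End DoubleBurnsideUnits.

(* [{unit R}] of the library requires R to be finite. *)
Record units (R : unitRingType) := Units {
  uval :> R;
  uvalP : uval \is a GRing.unit
}.

HB.instance Definition _ (R : unitRingType) := [isSub for @uval R].
HB.instance Definition _ (R : unitRingType) := [Choice of units R by <:].

Section UnitsGroup.
Variable R : unitRingType.
Implicit Types u v w : units R.

Definition units1 : units R := Units (unitr1 R).
Fact unitsM_subproof u v : (uval u * uval v)%R \is a GRing.unit.
Proof. by rewrite unitrMl ?uvalP. Qed.
Definition unitsM u v : units R := Units (unitsM_subproof u v).
Fact unitsV_subproof u : (uval u)^-1%R \is a GRing.unit.
Proof. by rewrite unitrV uvalP. Qed.
Definition unitsV u : units R := Units (unitsV_subproof u).

Fact unitsMA : associative unitsM.
Proof. by move=> u v w; apply: val_inj; apply: mulrA. Qed.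
Fact units1M : left_id units1 unitsM.
Proof. by move=> u; apply: val_inj; apply: mul1r. Qed.
Fact unitsM1 : right_id units1 unitsM.
Proof. by move=> u; apply: val_inj; apply: mulr1. Qed.
Fact unitsVM : left_inverse units1 unitsV unitsM.
Proof. by move=> u; apply: val_inj; apply/mulVr/uvalP. Qed.
Fact unitsMV : right_inverse units1 unitsV unitsM.
Proof. by move=> u; apply: val_inj; apply/mulrV/uvalP. Qed.

HB.instance Definition _ := isGroup.Build (units R)
  unitsMA units1M unitsM1 unitsVM unitsMV.

End UnitsGroup.

Lemma morphT_coset (gT : finGroupType) (N : {group gT}) :
  (N <| [set: gT])%g -> {morph coset N : x y / (x * y)%g}.
Proof.
by move=> /normal_norm nN x y; rewrite morphM // (subsetP nN) ?inE.
Qed.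

Section InfDef.
Variables (gT : finGroupType) (N : {group gT}) (nN : (N <| [set: gT])%g).

Definition inf_biset_mixin : bisetMixin gT (coset_of N) (coset_of N).
Proof.
exists (fun g x => coset N g * x)%g (fun x y => x * y)%g => *;
  by rewrite ?(morphT_coset nN) ?morph1 ?mulg1 ?mul1g ?mulgA.
Defined.

Definition def_biset_mixin : bisetMixin (coset_of N) gT (coset_of N).
Proof.
exists (fun y x => y * x)%g (fun x g => x * coset N g)%g => *;
  by rewrite ?(morphT_coset nN) ?morph1 ?mulg1 ?mul1g ?mulgA.
Defined.

Definition Inf : B gT (coset_of N) := bcl (Biset inf_biset_mixin).
Definition Def : B (coset_of N) gT := bcl (Biset def_biset_mixin).

Definition dBInf (u : B (coset_of N) (coset_of N)) : B gT gT :=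
  IdB gT + Inf \oB (u - IdB (coset_of N)) \oB Def.

End InfDef.

(* [X] is sent to X with G' acting on both sides through a : G' -> G. When a is an
   isomorphism this identifies B(G, G) with B(G', G'). *)
Definition resB (G G' : finGroupType) (a : G' -> G)
    (aM : {morph a : x y / (x * y)%g}) (u : B G G) : B G' G' :=
  groth_lift (fun c => groth_inj (isoclass_res aM aM c)) u.

Lemma resB_bcl (G G' : finGroupType) (a : G' -> G)
    (aM : {morph a : x y / (x * y)%g}) (X : biset G G) :
  resB aM (bcl X) = bcl (res_biset aM aM X).
Proof.
rewrite /resB groth_lift_inj => [|c d].
  by rewrite /isoclass_res; apply/bcl_iso/res_biset_iso/class_repP.
rewrite -groth_injD; congr groth_inj.
rewrite -(class_repK c) -(class_repK d) -class_of_sum !isoclass_resE -class_of_sum.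
exact/class_ofE/res_biset_sum.
Qed.

Lemma coset1_bij (gT : finGroupType) :
  bijective (coset (1%G : {group gT})).
Proof.
exists (fun y : coset_of (1%G : {group gT}) => fingroup.repr y) => x; last exact: coset_reprK.
have n1 z : z \in 'N(1%G : {group gT})%g by rewrite norm1 inE.
have /(kercoset_rcoset (n1 _) (n1 _))[z] :
  coset 1%G (fingroup.repr (coset 1%G x)) = coset 1%G x by apply: coset_reprK.
by rewrite inE => /eqP -> ->; rewrite mul1g.
Qed.

Section ThirdIso.
Variables (gT : finGroupType) (N M : {group gT}).

(* (xN)(M/N) |-> xM, cf [third_mapE]. *)
Definition third_map (x : coset_of (M / N)%g) : coset_of M :=
  coset M (fingroup.repr (fingroup.repr x)).

Hypotheses (nN : (N <| [set: gT])%g) (nM : (M <| [set: gT])%g) (sNM : N \subset M).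

Lemma quotientT : ([set: gT] / N)%g = [set: coset_of N].
Proof.
apply/setP=> y; rewrite inE; have [x Nx ->] := cosetP y.
by rewrite mem_quotient ?inE.
Qed.

Lemma normalT_quotient : ((M / N)%G <| [set: coset_of N])%g.
Proof. by rewrite -quotientT; apply: quotient_normal. Qed.

Lemma third_mapE x : third_map (coset (M / N)%g (coset N x)) = coset M x.
Proof.
have nNT z : z \in 'N(N)%g by rewrite (subsetP (normal_norm nN)) ?inE.
have nMT z : z \in 'N(M)%g by rewrite (subsetP (normal_norm nM)) ?inE.
have nMNT y : y \in 'N(M / N)%g.
  by rewrite (subsetP (normal_norm normalT_quotient)) ?inE.
rewrite /third_map; set y := fingroup.repr (coset _ (coset N x)).
have /(kercoset_rcoset (nMNT _) (nMNT _))[z] : coset (M / N)%g y = coset (M / N)%g (coset N x).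
  exact: coset_reprK.
case/morphimP=> m _ Mm -> /= ->; rewrite -morphM ?nNT //=.
have /(kercoset_rcoset (nNT _) (nNT _))[n Nn ->] :
    coset N (fingroup.repr (coset N (m * x)%g)) = coset N (m * x)%g by apply: coset_reprK.
by rewrite mulgA coset_kerl // groupM // (subsetP sNM).
Qed.

Lemma third_mapM : {morph third_map : x y / (x * y)%g}.
Proof.
move=> x y; have [x' _ ->] := cosetP x; have [x0 _ ->] := cosetP x'.
have [y' _ ->] := cosetP y; have [y0 _ ->] := cosetP y'.
have q1 := morphT_coset nN; have q2 := morphT_coset normalT_quotient.
by rewrite -q2 -q1 !third_mapE (morphT_coset nM).
Qed.

Lemma third_map_bij : bijective third_map.
Proof.
have nNT z : z \in 'N(N)%g by rewrite (subsetP (normal_norm nN)) ?inE.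
have nMT z : z \in 'N(M)%g by rewrite (subsetP (normal_norm nM)) ?inE.
exists (fun y : coset_of M => coset (M / N)%g (coset N (fingroup.repr y))) => x.
  have [x' _ ->] := cosetP x; have [x0 _ ->] := cosetP x'; rewrite third_mapE.
  have /(kercoset_rcoset (nMT _) (nMT _))[m Mm ->] :
    coset M (fingroup.repr (coset M x0)) = coset M x0 by apply: coset_reprK.
  by rewrite (morphT_coset nN) coset_kerl // mem_quotient.
by rewrite third_mapE; apply: coset_reprK.
Qed.

End ThirdIso.

(* Main.v *)
Require Import Defs.
From HB Require Import structures.
From mathcomp Require Import all_boot all_order all_algebra all_fingroup.
Set Implicit Arguments.
Unset Strict Implicit.
Unset Printing Implicit Defensive.

Import GRing.Theory.
Local Open Scope group_scope.
Local Open Scope ring_scope.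

(** The proof rests on two facts about inflation I and deflation D along the
    quotient map G -> G/N.

    Since the quotient map is surjective, D o I = Id ([Def_Inf]).  Hence
    u |-> I o u o D is additive and multiplicative (it does not preserve the
    identity: it sends Id to the idempotent I o D), and correcting it to
    u |-> Id + I o (u - Id) o D turns it into a map that preserves both products
    and the identity, because (u - 1) + (v - 1) + (u - 1)(v - 1) = uv - 1.  It is
    injective since D o dBInf u o I = D o I + (D o I) o (u - Id) o (D o I) = u.

    Moreover I o X o D is X itself with G acting on both sides through G/N
    ([Inf_circ_Def]), so that dBInf u = Id + res (u - Id) where res denotes
    restriction along the quotient map.  Restrictions compose ([resB_comp]), and
    restriction along an isomorphism preserves Id ([resB_IdB]).  The first gives
    transitivity, where the inner Id of dBInf cancels against the outer - Id, and
    the second identifies G/1 with G and (G/N)/(M/N) with G/M. *)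

(** * Restriction of bisets and tensor products *)

Lemma morph_idfun (G : finGroupType) : {morph (@id G) : x y / (x * y)%g}.
Proof. by []. Qed.

Section TensorRestriction.
Variables G G' H H' K K' : finGroupType.

(** Both sides have the same orbits: H acts in the same way on X before and after
    restricting the left action, so the identity map is an isomorphism. *)
Lemma tens_biset_resl (a : G' -> G) (aM : {morph a : x y / (x * y)%g})
    (X : biset G H) (Y : biset H K) :
  biset_iso (tens_biset (res_biset aM (@morph_idfun H) X) Y)
            (res_biset aM (@morph_idfun K) (tens_biset X Y)).
Proof.
exists id; split; first by exists id.
- by move=> g A; apply: val_inj.
- by move=> A k; apply: val_inj.
Qed.

Lemma tens_biset_resr (b : K' -> K) (bM : {morph b : x y / (x * y)%g})
    (X : biset G H) (Y : biset H K) :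
  biset_iso (tens_biset X (res_biset (@morph_idfun H) bM Y))
            (res_biset (@morph_idfun G) bM (tens_biset X Y)).
Proof.
exists id; split; first by exists id.
- by move=> g A; apply: val_inj.
- by move=> A k; apply: val_inj.
Qed.

(** A surjection onto the middle group does not change the orbits over which the
    tensor product is taken. *)
Lemma tens_biset_res_surj (c : H' -> H) (cM : {morph c : x y / (x * y)%g})
    (X : biset G H) (Y : biset H K) :
    (forall h, exists h', c h' = h) ->
  biset_iso (tens_biset (res_biset (@morph_idfun G) cM X)
                        (res_biset cM (@morph_idfun K) Y))
            (tens_biset X Y).
Proof.
move=> c_surj; set X' := res_biset _ _ X; set Y' := res_biset _ _ Y.
have cV h : c h^-1%g = (c h)^-1%g.
  by apply: (mulgI (c h)); rewrite -cM !mulgV; apply: morph_id1 cM.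
pose pi := @tens_pi _ _ _ X Y; pose pi' := @tens_pi _ _ _ X' Y'.
apply: (@biset_iso_rel G K (tens_biset X' Y') (tens_biset X Y)
  (fun A B => exists x y, A = pi' (x, y) /\ B = pi (x, y))).
- by move=> A; have [[x y] ->] := tens_pi_surj A; exists (pi (x, y)), x, y.
- by move=> A; have [[x y] ->] := tens_pi_surj A; exists (pi' (x, y)), x, y.
- move=> _ _ _ _ [x [y [-> ->]]] [x' [y' [-> ->]]].
  split=> /tens_pi_pairE[h [-> ->]].
    by apply/tens_pi_pairE; exists (c h); rewrite -cV.
  have [h' <-] := c_surj h; apply/(@tens_pi_pairE _ _ _ X' Y').
  by exists h'; rewrite -cV.
- move=> g _ _ [x [y [-> ->]]]; exists (lact g x), y.
  by rewrite /pi /pi' !lact_tens_pi.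
- move=> k _ _ [x [y [-> ->]]]; exists x, (Defs.ract y k).
  by rewrite /pi /pi' !ract_tens_pi.
Qed.

End TensorRestriction.

(** * Restriction on the double Burnside group *)

Section ResB.
Variables G G' : finGroupType.
Variables (a : G' -> G) (aM : {morph a : x y / (x * y)%g}).

Lemma resBB : {morph resB aM : u v / u - v}.
Proof.
apply: groth_liftB => c d; rewrite -groth_injD; congr groth_inj.
rewrite -(class_repK c) -(class_repK d) -class_of_sum !isoclass_resE.
rewrite -class_of_sum; exact/class_ofE/res_biset_sum.
Qed.

Lemma resB_IdB : bijective a -> resB aM (IdB G) = IdB G'.
Proof.
move=> a_bij; rewrite resB_bcl; apply/bcl_iso/biset_iso_sym.
by exists (a : id_biset G' -> res_biset aM aM (id_biset G)); split.
Qed.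

End ResB.

Lemma resB_comp (G G' G'' : finGroupType)
    (a : G' -> G) (b : G'' -> G') (c : G'' -> G)
    (aM : {morph a : x y / (x * y)%g}) (bM : {morph b : x y / (x * y)%g})
    (cM : {morph c : x y / (x * y)%g}) :
  c =1 a \o b -> forall u, resB bM (resB aM u) = resB cM u.
Proof.
move=> cE; elim/B_ind=> [X|x y Ex Ey]; last first.
  by rewrite (resBB aM) (resBB bM) (resBB cM) Ex Ey.
rewrite !resB_bcl; apply: bcl_iso; exists id; split; first by exists id.
  by move=> g x; rewrite /lact /= cE.
by move=> x h; rewrite /Defs.ract /= cE.
Qed.

(** * Inflation and deflation *)

Section InfDefTheory.
Variables (gT : finGroupType) (N : {group gT}) (nN : (N <| [set: gT])%g).
Let qM := morphT_coset nN.

Lemma Inf_res :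
  Inf nN = bcl (res_biset qM (@morph_idfun _) (id_biset (coset_of N))).
Proof. by apply: bcl_iso; exists id; split=> //; exists id. Qed.

Lemma Def_res :
  Def nN = bcl (res_biset (@morph_idfun _) qM (id_biset (coset_of N))).
Proof. by apply: bcl_iso; exists id; split=> //; exists id. Qed.

(** G maps onto G/N, so the product of two copies of G/N over G is their product
    over G/N. *)
Lemma Def_Inf : Def nN \oB Inf nN = IdB (coset_of N).
Proof.
rewrite Inf_res Def_res circE -[RHS]circ1l circE.
apply/bcl_iso/tens_biset_res_surj => y.
by have [x _ ->] := cosetP y; exists x.
Qed.

(** Inflation and deflation are restrictions of the identity biset of G/N, and
    restricting the outer action of a factor commutes with the product; the
    identity bisets then disappear. *)
Lemma Inf_circ_Def u : Inf nN \oB u \oB Def nN = resB qM u.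
Proof.
elim/B_ind: u => [X|x y Ex Ey]; last by rewrite circBr circBl resBB Ex Ey.
rewrite Inf_res Def_res !circE resB_bcl; apply: bcl_iso.
apply: biset_iso_trans (tens_biset_resr qM _ _) _.
have iX : biset_iso (tens_biset (res_biset qM (@morph_idfun _) (id_biset _)) X)
                    (res_biset qM (@morph_idfun _) X).
  apply: biset_iso_trans (tens_biset_resl qM _ _) _.
  exact/res_biset_iso/tens_id_bisetl.
apply: biset_iso_trans (res_biset_iso _ _ (tens_id_bisetr _)) _.
apply: biset_iso_trans (res_biset_iso _ _ iX) _.
by exists id; split=> //; exists id.
Qed.

(** * The map dBInf *)

Lemma mulBE (G : finGroupType) (u v : B G G) : u * v = u \oB v.
Proof. by []. Qed.

Lemma dBInf_resB u : dBInf nN u = IdB gT + resB qM (u - IdB (coset_of N)).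
Proof. by rewrite /dBInf Inf_circ_Def. Qed.

Lemma dBInf1 : dBInf nN 1 = 1.
Proof. by rewrite /dBInf subrr -(subrr 0) circBr circBl subrr addr0. Qed.

Lemma dBInfM : {morph dBInf nN : u v / u * v}.
Proof.
pose T u := Inf nN \oB u \oB Def nN.
have TM u v : T u * T v = T (u * v).
  have -> : T u * T v = Inf nN \oB u \oB (Def nN \oB Inf nN) \oB v \oB Def nN.
    by rewrite mulBE /T !circA.
  by rewrite Def_Inf circ1r -(circA _ u).
have TD : {morph T : u v / u + v} by move=> u v; rewrite /T circDr circDl.
move=> u v; rewrite [RHS]mulrDl mul1r mulrDr mulr1 -/(T (u - 1)) -/(T (v - 1)).
rewrite TM -addrA -!TD; congr (1 + T _).
rewrite -{1}[u - 1]mulr1 -mulrDr [1 + _]addrC subrK mulrBl mul1r.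
by rewrite [RHS]addrC addrA subrK.
Qed.

(** Sandwiching dBInf u between D and I recovers u. *)
Lemma dBInf_inj : injective (dBInf nN).
Proof.
apply: (can_inj (g := fun w => Def nN \oB w \oB Inf nN)) => u.
rewrite /dBInf circDr circDl circ1r Def_Inf.
rewrite !circA Def_Inf circ1l -circA Def_Inf circ1r.
by rewrite addrC subrK.
Qed.

End InfDefTheory.

(** * The map on groups of units *)

Section UnitsMap.
Variables (R S : unitRingType) (f : R -> S).
Hypotheses (f1 : f 1 = 1) (fM : {morph f : x y / x * y}).

Fact units_map_subproof (u : units R) : f (uval u) \is a GRing.unit.
Proof.
by apply/unitrP; exists (f (uval u)^-1); rewrite -!fM ?mulVr ?mulrV ?uvalP.
Qed.

Definition units_map (u : units R) : units S := Units (units_map_subproof u).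

Fact units_mapM : {morph units_map : u v / (u * v)%g}.
Proof. by move=> u v; apply: val_inj; apply: fM. Qed.

HB.instance Definition _ := isMultiplicative.Build (units R) (units S)
  units_map units_mapM.

End UnitsMap.

Theorem mainTheorem2 (gT : finGroupType) (N : {group gT})
    (nN : (N <| [set: gT])%g) :
  (exists f : {multiplicative units (B (coset_of N) (coset_of N)) ->
                 units (B gT gT)},
     injective f /\ forall u, uval (f u) = dBInf nN (uval u))
  /\ (forall u : units (B (coset_of (1%G : {group gT}))
                          (coset_of (1%G : {group gT}))),
        dBInf (normal1 [set: gT]) (uval u) =
          resB (morphT_coset (normal1 [set: gT])) (uval u))
  /\ (forall (M : {group gT}) (nM : (M <| [set: gT])%g)
            (sNM : N \subset M),
        forall u : units (B (coset_of M) (coset_of M)),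
          dBInf nN (dBInf (normalT_quotient N nM)
                          (resB (third_mapM nN nM sNM) (uval u))) =
          dBInf nM (uval u)).
Proof.
split; last split.
- exists (units_map (dBInf1 nN) (dBInfM nN)); split=> // u v /(congr1 val).
  by move/dBInf_inj/val_inj.
- move=> u; rewrite dBInf_resB resBB (resB_IdB _ (coset1_bij gT)).
  by rewrite addrC subrK.
- move=> M nM sNM u; set aM := third_mapM nN nM sNM.
  (* The identity of G/N cancels, and the one of (G/N)/(M/N) is restricted from G/M. *)
  rewrite !dBInf_resB [IdB (coset_of N) + _]addrC addrK.
  rewrite -(resB_IdB aM (third_map_bij nN nM sNM)) -resBB.
  congr (_ + _).
  set bM := morphT_coset (normalT_quotient N nM).
  have baM : {morph @third_map gT N M \o coset (M / N)%g : x y / (x * y)%g}.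
    by move=> x y; rewrite /= bM aM.
  rewrite (resB_comp aM bM baM) // (resB_comp baM _ (morphT_coset nM)) //.
  by move=> x /=; rewrite third_mapE.
Qed.
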